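(* Let $P$ be a Dedekind Poisson algebra over an arbitrary field $F$, with idempotent--nil decomposition $P(+,\cdot)=E\oplus N$ (described in the context), and suppose $N^2=Fc\neq0$. Then there exist vector subspaces $V,Z\le N$ such that $$N=V\oplus Z\oplus Fc,\qquad \operatorname{Ann}(N)=Z\oplus Fc,$$ and there are bilinear forms $\beta,\omega:V\times V\to F$ such that $$uv=\beta(u,v)c,\qquad [u,v]=\omega(u,v)c\qquad(u,v\in V).$$ The form $\beta$ is symmetric and satisfies $\beta(v,v)\neq0$ for every $0\neq v\in V$, while $\omega$ is alternating. Moreover, $$ZP=Fc\,P=0\qquad\text{and}\qquad [Z,P]=[c,P]=0.$$
   Context: A Poisson algebra over a field $F$ is an $F$-vector space $P$ with a bilinear commutative associative multiplication $xy$ (no identity element is assumed) and an alternating Lie bracket $[\,,\,]$ ($[x,x]=0$ for all $x$) satisfying $[xy,z]=x[y,z]+y[x,z]$. A Poisson subalgebra is a subspace closed under both operations; a Poisson ideal is a subspace $I$ with $PI\subseteq I$ and $[P,I]\subseteq I$. A Poisson algebra is Dedekind if every Poisson subalgebra is a Poisson ideal. No finite-dimensionality is assumed. Idempotent--nil decomposition of a Dedekind Poisson algebra $P$: the associative algebra $P(+,\cdot)$ has at most one non-zero idempotent. If it has none, $E=0$ and $N=P$; if $e$ is the non-zero idempotent, $E=Fe$ and $N=\{x\in P: ex=0\}$. One has $P(+,\cdot)=E\oplus N$ as a direct sum of associative ideals, $EN=0$, $N^3=0$, $\dim_FN^2\le1$. Here $N^2$ is the linear span of products of two elements of $N$, $N^3=N^2N$,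 $\operatorname{Ann}(N)=\{a\in N\mid aN=0\}$. A bilinear form $\omega$ is alternating if $\omega(v,v)=0$ for all $v$. The sums $V\oplus Z\oplus Fc$ and $Z\oplus Fc$ are direct sums of vector spaces. *)

(* Defs.v *)
From HB Require Import structures.
From mathcomp Require Import all_boot all_order all_algebra.
From mathcomp Require Import boolp classical_sets.

Set Implicit Arguments.
Unset Strict Implicit.
Unset Printing Implicit Defensive.

Import GRing.Theory.

Local Open Scope classical_set_scope.
Local Open Scope ring_scope.

Reserved Notation "x ** y" (at level 40, left associativity).
Reserved Notation "{[ x , y ]}" (at level 0, x at level 99, y at level 99).

(* Neither a unit nor finite dimension is assumed, so the commutative product
   is not an instance of the ring hierarchy. *)
HB.mixin Record isPoissonAlgebra (F : fieldType) P of GRing.Lmodule F P := {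
  pmul : P -> P -> P;
  pbracket : P -> P -> P;
  pmul_bilinear : bilinear_for *:%R *:%R pmul;
  pmulC : commutative pmul;
  pmulA : associative pmul;
  pbracket_bilinear : bilinear_for *:%R *:%R pbracket;
  pbracketxx : forall x, pbracket x x = 0;
  pjacobi : forall x y z,
    pbracket x (pbracket y z) + pbracket y (pbracket z x)
      + pbracket z (pbracket x y) = 0;
  pleibniz : forall x y z,
    pbracket (pmul x y) z = pmul x (pbracket y z) + pmul y (pbracket x z)
}.

#[short(type="poissonAlgType")]
HB.structure Definition PoissonAlgebra (F : fieldType) :=
  {P of GRing.Lmodule F P & isPoissonAlgebra F P}.

Notation "x ** y" := (pmul x y) : ring_scope.
Notation "{[ x , y ]}" := (pbracket x y) : ring_scope.

Section VectorSpaces.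
Variables (F : fieldType) (W : lmodType F).
Implicit Types (A S : set W) (s : seq (set W)).

Definition subspace A : Prop := submod_closed [in A].

Definition line (c : W) : set W := [set a *: c | a in [set: F]].

Definition lspan A : set W :=
  [set x | exists n (a : 'I_n -> F) (v : 'I_n -> W),
     (forall i, A (v i)) /\ x = \sum_i a i *: v i].

Definition sum_of s : set W :=
  foldr (fun A S => [set x + y | x in A & y in S]) [set 0] s.

Fixpoint independent s : Prop :=
  if s is A :: s' then A `&` sum_of s' = [set 0] /\ independent s' else True.

Definition is_direct_sum S s : Prop := S = sum_of s /\ independent s.

(* A bilinear form A * A -> F on a subspace A is encoded by a function on W
   whose values off A are irrelevant. *)
Definition bilinear_form_on A (f : W -> W -> F) : Prop :=
  (forall a u v w, A u -> A v -> A w -> f (a *: u + v) w = a * f u w + f v w)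
  /\ (forall a u v w, A u -> A v -> A w ->
        f w (a *: u + v) = a * f w u + f w v).

Definition symmetric_on A (f : W -> W -> F) : Prop :=
  forall u v, A u -> A v -> f u v = f v u.

Definition alternating_on A (f : W -> W -> F) : Prop :=
  forall v, A v -> f v v = 0.

End VectorSpaces.

Section Dedekind.
Variables (F : fieldType) (P : poissonAlgType F).
Implicit Types (S I A B E N : set P).

Definition poisson_subalgebra S : Prop :=
  [/\ subspace S,
      forall x y, S x -> S y -> S (x ** y)
    & forall x y, S x -> S y -> S {[x, y]}].

Definition poisson_ideal I : Prop :=
  [/\ subspace I,
      forall p x, I x -> I (p ** x)
    & forall p x, I x -> I {[p, x]}].

Definition dedekind : Prop :=
  forall S, poisson_subalgebra S -> poisson_ideal S.

Definition mulspan A B : set P := lspan [set x ** y | x in A & y in B].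

(* In a Dedekind Poisson algebra a non-zero idempotent is unique if it exists,
   so this relation then determines E and N. *)
Definition idempotent_nil_decomposition E N : Prop :=
  [/\ forall e : P, e ** e = e -> e = 0, E = [set 0] & N = [set: P]] \/
  (exists e : P, [/\ e <> 0, e ** e = e, E = line e
                   & N = [set x | e ** x = 0]]).

Definition ann N : set P := [set a | N a /\ forall x, N x -> a ** x = 0].

End Dedekind.

Arguments dedekind {F} P.

(* Main.v *)
Require Import Defs.
From HB Require Import structures.
From mathcomp Require Import all_boot all_order all_algebra.
From mathcomp Require Import boolp classical_sets.

Set Implicit Arguments.
Unset Strict Implicit.
Unset Printing Implicit Defensive.

Import GRing.Theory.

Local Open Scope classical_set_scope.
Local Open Scope ring_scope.

(** The Dedekind condition turns a subalgebra into an ideal, and two kinds of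
    subalgebras suffice: the line of an element whose square lies on it, and
    the multiples of [y] plus the associative ideal of [y ** y].

    _Cubes vanish on [N]._ The second subalgebra, taken for [y = x ** x], is an
    ideal and so contains [x ** y]. This makes the cube of [x] absorb
    some [h] in the associative ideal of [x] ([cube_absorbs]), and [h ** h ** h] is then an idempotent
    fixing the cube of [x] ([idempotent_of_cube]). When [x] is in [N] this
    idempotent is orthogonal to the given one, if any, and two orthogonal
    idempotents cannot both be non-zero ([orthogonal_idempotents]).

    _The associative structure._ If [y ** y = 0], the line of [y] is an ideal on
    which the nilpotent elements of [N] act by scalars, hence by zero. So an
    element of [N] of square zero annihilates [N]
    ([sq0_annihilates]), which is the anisotropy of [beta]; likewise [c]
    annihilates [N]. An idempotent is moreover central for the bracket
    ([idempotent_bracket]), so every statement about [P] reduces to one about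
    [N] ([nil_component_supplement]).

    _The bracket._ For [v] in [N], [{[p, v]}] is a combination of [v] and [c]
    ([bracket_span]). If [v ** v] is not zero, it is proportional to [c],
    and its bracket with [v] is zero; such [v] generate [N] additively, so [c]
    is central for the bracket ([bracket_cN]). Comparing the two descriptions of [{[u, v]}], as
    a combination of [u] and [c] and as one of [v] and [c], then puts it in the
    line of [c] ([bracket_line]). For [z] in the annihilator of [N], [{[z, x]}]
    is also in the line of [z], so it vanishes when [z] is independent of [c]
    ([bracket_annihilator]).

    Hence [Z] can be any complement of the line of [c] in the annihilator of
    [N], and [V] any complement of that annihilator in [N]. *)

(** * Subspaces and their complements *)

Section Subspaces.
Variables (F : fieldType) (W : lmodType F).
Implicit Types (A B M N : set W) (s : seq (set W)).

Lemma subspaceP A :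
  subspace A <-> A 0 /\ forall a u v, A u -> A v -> A (a *: u + v).
Proof.
split=> -[A0 AL]; first split; first by rewrite inE in A0.
  move=> a u v Au Av; have := AL a u v; rewrite !inE; exact.
by split=> [|a u v]; rewrite !inE //; apply: AL.
Qed.

Lemma subspace0 A : subspace A -> A 0.
Proof. by move/subspaceP=> []. Qed.

Lemma subspaceZ A a u : subspace A -> A u -> A (a *: u).
Proof. by move/subspaceP=> [A0 AL] Au; rewrite -[_ *: _]addr0; apply: AL. Qed.

Lemma subspaceD A u v : subspace A -> A u -> A v -> A (u + v).
Proof. by move/subspaceP=> [_ AL] Au Av; rewrite -[u]scale1r; apply: AL. Qed.

Lemma subspaceB A u v : subspace A -> A u -> A v -> A (u - v).
Proof.
by move=> sA Au Av; rewrite -scaleN1r; apply: subspaceD => //; apply: subspaceZ.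
Qed.

Lemma subspace_line (c : W) : subspace (line c).
Proof.
apply/subspaceP; split; first by exists 0; rewrite ?scale0r.
by move=> a _ _ [b _ <-] [d _ <-]; exists (a * b + d); rewrite // scalerDl scalerA.
Qed.

Lemma line_id (c : W) : line c c.
Proof. by exists 1; rewrite ?scale1r. Qed.

Lemma direct_sum_line (c : W) : is_direct_sum (line c) [:: line c].
Proof.
split=> /=.
  apply/seteqP; split=> x /= => [lx | [y ly [_ -> <-]]]; last by rewrite addr0.
  by exists x => //; exists 0; rewrite ?addr0.
split=> //; apply/seteqP; split=> x /=; first by case.
by move=> ->; split=> //; apply: subspace0; exact: subspace_line.
Qed.

(** Zorn's lemma yields a subset [V] of [N], closed under linear combinations
    and meeting [A] only in [0], that is maximal for these properties; a vector
    of [N] outside [V + A] could be adjoined to [V]. *)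
Lemma exists_complement N A :
  subspace N -> subspace A -> A `<=` N ->
  exists V, [/\ subspace V, V `<=` N, V `&` A = [set 0]
              & forall x, N x -> exists2 v, V v & A (x - v)].
Proof.
move=> sN sA AN.
(* [0] is not required to lie in the candidates, so that the union of the
   empty chain is one of them. *)
pose good M := [/\ forall a u v, M u -> M v -> M (a *: u + v), M `<=` N
                 & forall x, M x -> A x -> x = 0].
have [|V [[VL VN VA] Vmax]] := @Zorn_bigcup _ good.
  move=> C Cgood Ctot; split.
  - move=> a u v [X CX Xu] [Y CY Yv].
    have [XY|YX] := Ctot _ _ CX CY.
      by exists Y => //; have [YL _ _] := Cgood _ CY; apply: YL => //; apply: XY.
    by exists X => //; have [XL _ _] := Cgood _ CX; apply: XL => //; apply: YX.
  - by move=> x [X CX Xx]; have [_ XN _] := Cgood _ CX; apply: XN.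
  - by move=> x [X CX Xx]; have [_ _ XA] := Cgood _ CX; apply: XA.
have V0 : V 0.
  apply: contrapT => nV0.
  have Vempty x : ~ V x.
    by move=> Vx; apply: nV0; rewrite -(addNr x) -scaleN1r; apply: VL.
  apply: (Vmax [set 0]).
    by split=> [x /Vempty // | /(_ 0 erefl)].
  split=> [a u v -> -> | x -> | x -> //]; first by rewrite /= scaler0 addr0.
  exact: subspace0.
have sV : subspace V by apply/subspaceP.
exists V; split=> //.
  apply/seteqP; split=> x /=; first by case; apply: VA.
  by move=> ->; split=> //; apply: subspace0.
move=> x Nx; apply: contrapT => nx.
apply: (Vmax [set v + a *: x | v in V & a in [set: F]]).
  split=> [v Vv | /(_ x) Vx].
    by exists v => //; exists 0; rewrite // scale0r addr0.
  apply: nx; exists x; last by rewrite subrr; apply: subspace0.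
  by apply: Vx; exists 0 => //; exists 1; rewrite // scale1r add0r.
split=> [a _ _ [u Vu [b _ <-]] [v Vv [d _ <-]] | _ [v Vv [b _ <-]] |].
- exists (a *: u + v); first exact: VL.
  by exists (a * b + d); rewrite // scalerDr scalerDl scalerA addrACA.
- by apply: subspaceD => //; [apply: VN | apply: subspaceZ].
- move=> _ [v Vv [b _ <-]] Avb.
  have [b0|b0] := eqVneq b 0.
    by move: Avb; rewrite b0 scale0r addr0; apply: VA.
  case: nx; exists (- b^-1 *: v); first exact: subspaceZ.
  rewrite scaleNr opprK -[x]scale1r -(mulVf b0) -scalerA -scalerDr addrC.
  exact: subspaceZ.
Qed.

Lemma direct_sum_extend N A s :
  subspace N -> subspace A -> A `<=` N -> is_direct_sum A s ->
  exists V, [/\ subspace V, V `<=` N, V `&` A = [set 0]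
              & is_direct_sum N (V :: s)].
Proof.
move=> sN sA AN [As indep_s].
have [V [sV VN VA NVA]] := exists_complement sN sA AN.
exists V; split=> //; split=> /=; last by rewrite -As.
rewrite -As; apply/seteqP; split=> x /= => [Nx | [v Vv [a Aa <-]]].
  have [v Vv Axv] := NVA x Nx.
  by exists v => //; exists (x - v); rewrite // addrC subrK.
by apply: subspaceD => //; [apply: VN | apply: AN].
Qed.

End Subspaces.

(** * Calculus in Poisson algebras *)

Section PoissonCalculus.
Variables (F : fieldType) (P : poissonAlgType F).
Implicit Types (x y z u v p : P) (a b k : F).

Lemma pmul_linear_l a x y z : (a *: x + y) ** z = a *: (x ** z) + y ** z.
Proof. by have [linl _] := @pmul_bilinear F P; exact: (linl z). Qed.

Lemma pmulDl x y z : (x + y) ** z = x ** z + y ** z.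
Proof. by rewrite -[x in LHS]scale1r pmul_linear_l scale1r. Qed.

Lemma pmul0l z : (0 : P) ** z = 0.
Proof. by apply: (addrI (0 ** z)); rewrite -pmulDl !addr0. Qed.

Lemma pmulZl a x z : (a *: x) ** z = a *: (x ** z).
Proof. by rewrite -[_ *: x]addr0 pmul_linear_l pmul0l addr0. Qed.

Lemma pmulDr x y z : x ** (y + z) = x ** y + x ** z.
Proof. by rewrite !(pmulC x) pmulDl. Qed.

Lemma pmul0r z : z ** (0 : P) = 0.
Proof. by rewrite pmulC pmul0l. Qed.

Lemma pmulZr a x z : x ** (a *: z) = a *: (x ** z).
Proof. by rewrite !(pmulC x) pmulZl. Qed.

Lemma pmulAC x y z : x ** y ** z = x ** z ** y.
Proof. by rewrite -!pmulA (pmulC y). Qed.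

Lemma pmulCA x y z : x ** (y ** z) = y ** (x ** z).
Proof. by rewrite !pmulA (pmulC x). Qed.

Lemma pbracket_linear_l a x y z :
  {[a *: x + y, z]} = a *: {[x, z]} + {[y, z]}.
Proof. by have [linl _] := @pbracket_bilinear F P; exact: (linl z). Qed.

Lemma pbracket_linear_r a x y z :
  {[z, a *: x + y]} = a *: {[z, x]} + {[z, y]}.
Proof. by have [_ linr] := @pbracket_bilinear F P; exact: (linr z). Qed.

Lemma pbracketDl x y z : {[x + y, z]} = {[x, z]} + {[y, z]}.
Proof. by rewrite -[x in LHS]scale1r pbracket_linear_l scale1r. Qed.

Lemma pbracketDr x y z : {[z, x + y]} = {[z, x]} + {[z, y]}.
Proof. by rewrite -[x in LHS]scale1r pbracket_linear_r scale1r. Qed.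

Lemma pbracket0l z : {[0 : P, z]} = 0.
Proof. by apply: (addrI {[0, z]}); rewrite -pbracketDl !addr0. Qed.

Lemma pbracket0r z : {[z, 0 : P]} = 0.
Proof. by apply: (addrI {[z, 0]}); rewrite -pbracketDr !addr0. Qed.

Lemma pbracketZl a x z : {[a *: x, z]} = a *: {[x, z]}.
Proof. by rewrite -[_ *: x]addr0 pbracket_linear_l pbracket0l addr0. Qed.

Lemma pbracketZr a x z : {[z, a *: x]} = a *: {[z, x]}.
Proof. by rewrite -[_ *: x]addr0 pbracket_linear_r pbracket0r addr0. Qed.

Lemma pbracketC x y : {[x, y]} = - {[y, x]}.
Proof.
apply/eqP; rewrite -addr_eq0; apply/eqP.
by have := pbracketxx (x + y); rewrite pbracketDl !pbracketDr !pbracketxx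
  add0r addr0.
Qed.

Lemma pleibniz_r x y z : {[z, x ** y]} = x ** {[z, y]} + y ** {[z, x]}.
Proof.
rewrite pbracketC pleibniz !(pbracketC z) -!scaleN1r scalerDr.
by rewrite !pmulZr.
Qed.

Lemma pbracket_sq x : {[x ** x, x]} = 0.
Proof. by rewrite pleibniz pbracketxx pmul0r addr0. Qed.

(** The associative ideal generated by [w]; the scalar term makes up for the
    missing unit. *)
Definition principal (w : P) : set P :=
  [set z | exists k p, z = k *: w + p ** w].

Lemma principal_id w : principal w w.
Proof. by exists 1, 0; rewrite scale1r pmul0l addr0. Qed.

Lemma principal_mul w p : principal w (p ** w).
Proof. by exists 0, p; rewrite scale0r add0r. Qed.

Lemma subspace_principal w : subspace (principal w).
Proof.
apply/subspaceP; split; first by exists 0, 0; rewrite scale0r pmul0l addr0.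
move=> a _ _ [k [p ->]] [l [q ->]]; exists (a * k + l), (a *: p + q).
by rewrite pmul_linear_l scalerDr scalerDl scalerA addrACA.
Qed.

Lemma principalM w z p : principal w z -> principal w (p ** z).
Proof.
move=> [k [q ->]]; rewrite pmulDr pmulZr pmulA.
apply: subspaceD; first exact: subspace_principal.
  by apply: subspaceZ; [exact: subspace_principal | exact: principal_mul].
exact: principal_mul.
Qed.

Lemma principalMM u v y z :
  principal u y -> principal v z -> principal (u ** v) (y ** z).
Proof.
move=> [k [p ->]] vz; rewrite pmulDl pmulZl -pmulA.
have uz : principal (u ** v) (u ** z).
  case: vz => l [q ->]; exists l, q.
  by rewrite pmulDr pmulZr pmulCA.
apply: subspaceD; first exact: subspace_principal.
  by apply: subspaceZ => //; exact: subspace_principal.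
exact: principalM.
Qed.

Lemma principal_fixed w z h : w ** h = w -> principal w z -> z ** h = z.
Proof. by move=> wh [k [p ->]]; rewrite pmulDl pmulZl -pmulA wh. Qed.

(** An explicit enlargement of the subalgebra generated by [y]. It is closed
    under the bracket because [y ** y] and [y] commute for it: by the Leibniz
    rule, bracketing with [y], then with any element of the ideal of [y ** y],
    maps that ideal to itself. *)
Lemma poisson_subalgebra_line_principal y :
  poisson_subalgebra
    [set k *: y + z | k in [set: F] & z in principal (y ** y)].
Proof.
have sI := subspace_principal (y ** y); set I := principal _ in sI *.
have Iy z : I z -> I {[z, y]}.
  move=> [k [p ->]]; rewrite pbracketDl pbracketZl pbracket_sq scaler0 add0r.
  rewrite pleibniz pbracket_sq pmul0r add0r pmulC; exact: principal_mul.
have II z t : I z -> I t -> I {[z, t]}.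
  move=> Iz [k [p ->]].
  have Izyy : I {[z, y ** y]}.
    by rewrite pleibniz_r; apply: subspaceD => //; apply: principalM; apply: Iy.
  rewrite pbracketDr pbracketZr; apply: subspaceD => //; first exact: subspaceZ.
  rewrite pleibniz_r; apply: subspaceD => //; first exact: principalM.
  by rewrite pmulC; exact: principal_mul.
split.
- apply/subspaceP; split.
    by exists 0 => //; exists 0; rewrite ?scale0r ?addr0 //; exact: subspace0.
  move=> a _ _ [k _ [z Iz <-]] [l _ [t It <-]].
  exists (a * k + l) => //; exists (a *: z + t).
    by apply: subspaceD => //; apply: subspaceZ.
  by rewrite scalerDr scalerDl scalerA addrACA.
- move=> _ _ [k _ [z Iz <-]] [l _ [t It <-]].
  exists 0 => //; exists ((k *: y + z) ** (l *: y + t)); last by rewrite scale0r add0r.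
  rewrite pmulDl !pmulDr !pmulZl !pmulZr.
  apply: subspaceD => //; apply: subspaceD => //.
  + by do 2!apply: subspaceZ => //; exact: principal_id.
  + by apply: subspaceZ => //; exact: principalM.
  + by apply: subspaceZ => //; rewrite pmulC; exact: principalM.
  + exact: principalM.
- move=> _ _ [k _ [z Iz <-]] [l _ [t It <-]].
  exists 0 => //; exists {[k *: y + z, l *: y + t]}; last by rewrite scale0r add0r.
  rewrite pbracketDl !pbracketDr !pbracketZl !pbracketZr pbracketxx !scaler0 add0r.
  apply: subspaceD => //; last apply: subspaceD => //; last exact: II.
    by rewrite (pbracketC y) -scaleN1r; do 2!apply: subspaceZ => //; exact: Iy.
  by apply: subspaceZ => //; exact: Iy.
Qed.

End PoissonCalculus.

(** * Cubes and idempotents *)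

Section DedekindAlgebra.
Variables (F : fieldType) (P : poissonAlgType F).
Hypothesis dedP : dedekind P.
Implicit Types (x y z u v p e f h : P).

(** The relation [x ** y = k *: y + z], where [y = x ** x] and [z] is in the
    associative ideal of [y ** y], is solved for [x ** y] if [k = 0], and
    otherwise for [y], which then absorbs [h]. *)
Lemma cube_absorbs x :
  exists2 h, principal x h & x ** x ** x ** h = x ** x ** x.
Proof.
have [_ idealM _] := dedP (poisson_subalgebra_line_principal (x ** x)).
have [|k _ [z [l [p ->]] /esym eq_cube]] := idealM x (x ** x).
  exists 1 => //; exists 0; last by rewrite scale1r addr0.
  by apply: subspace0; exact: subspace_principal.
have sx := subspace_principal x.
have xxx : principal x (l *: x + p ** x) by exists l, p.
have [k0|k0] := eqVneq k 0.
  exists (l *: x + p ** x) => //.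
  rewrite -[RHS]pmulA eq_cube k0 scale0r add0r pmulDr pmulZr (pmulCA _ p).
  by rewrite -!pmulA.
exists (k^-1 *: (x - x ** (l *: x + p ** x))).
  apply: subspaceZ => //; apply: subspaceB => //; first exact: principal_id.
  exact: principalM.
have eq_sq : k^-1 *: (x ** x ** (x - x ** (l *: x + p ** x))) = x ** x.
  have -> : x ** x ** (x - x ** (l *: x + p ** x)) = k *: (x ** x).
    rewrite pmulDr -scaleN1r pmulZr scaleN1r -pmulA eq_cube.
    apply/eqP; rewrite subr_eq; apply/eqP; congr (_ + _).
    by rewrite !pmulDr !pmulZr !(pmulCA _ p) -!pmulA.
  by rewrite scalerA mulVf // scale1r.
by rewrite pmulZr (pmulAC _ x) -pmulZl eq_sq.
Qed.

(** If the cube of [x] absorbs [h], so does its associative ideal, and this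
    contains [h ** h ** h]. *)
Lemma idempotent_of_cube x :
  exists f, [/\ f ** f = f, x ** x ** x ** f = x ** x ** x
              & principal (x ** x ** x) f].
Proof.
have [h xh cube_h] := cube_absorbs x.
have hhh := principalMM (principalMM xh xh) xh.
exists (h ** h ** h); split=> //; last by rewrite pmulA [X in X ** h]pmulA !cube_h.
by rewrite [LHS]pmulA pmulA !(principal_fixed cube_h hhh).
Qed.

Lemma line_ideal y p :
  line y (y ** y) -> line y (p ** y) /\ line y {[p, y]}.
Proof.
move=> yy; have [|_ idM idB] := dedP (S := line y); last first.
  by split; [apply: idM | apply: idB]; exact: line_id.
split=> [|_ _ [a _ <-] [b _ <-] |_ _ [a _ <-] [b _ <-]].
- exact: subspace_line.
- by rewrite pmulZl pmulZr; do 2!apply: (subspaceZ _ (subspace_line y)).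
- rewrite pbracketZl pbracketZr pbracketxx !scaler0.
  by apply: subspace0; exact: subspace_line.
Qed.

(** The line of the idempotent [e + f] is an ideal and so contains
    [e = e ** (e + f)], which is impossible if neither [e] nor [f] is zero. *)
Lemma orthogonal_idempotents e f :
  e ** e = e -> f ** f = f -> e ** f = 0 -> e <> 0 -> f = 0.
Proof.
move=> ee ff ef e0.
have fe : f ** e = 0 by rewrite pmulC.
have eM : e ** (e + f) = e by rewrite pmulDr ee ef addr0.
have [|[a _ ae] _] := @line_ideal (e + f) e.
  have -> : (e + f) ** (e + f) = e + f by rewrite pmulDl eM pmulDr ff fe add0r.
  exact: line_id.
rewrite eM in ae.
have : a *: f = 0.
  have := congr1 (fun t => f ** t) ae.
  by rewrite pmulZr pmulDr ff fe add0r.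
move/eqP; rewrite scaler_eq0 => /orP[/eqP a0|/eqP //].
by case: e0; rewrite -ae a0 scale0r.
Qed.

(** An idempotent is central for the bracket: [{[e, p]}] lies in the line of
    [e], hence is fixed by [e], whereas the Leibniz rule applied to [e ** e]
    makes it equal to twice itself. *)
Lemma idempotent_bracket e p : e ** e = e -> {[e, p]} = 0.
Proof.
move=> ee.
have [|_ [a _ ea]] := @line_ideal e p; first by rewrite ee; exact: line_id.
have : {[e, p]} = - a *: e by rewrite pbracketC -ea scaleNr.
move=> eb; have := pleibniz e e p.
rewrite ee {2 3}eb pmulZr ee -eb => /eqP.
by rewrite -subr_eq subrr => /eqP.
Qed.

Lemma nil_component_cube0 (E N : set P) x :
  idempotent_nil_decomposition E N -> N x -> x ** x ** x = 0.
Proof.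
have [f [ff cube_f cubeMf]] := idempotent_of_cube x.
case=> [[no_idem _ _] _ | [e [e0 ee _ ->]] /= ex].
  by rewrite -cube_f (no_idem f ff) pmul0r.
rewrite -cube_f (orthogonal_idempotents ee ff) ?pmul0r //.
have e_cube : e ** (x ** x ** x) = 0 by rewrite !pmulA ex !pmul0l.
case: cubeMf => k [p ->].
by rewrite pmulDr pmulZr (pmulCA e p) e_cube pmul0r scaler0 addr0.
Qed.

Lemma nil_component_ideal (E N : set P) :
  idempotent_nil_decomposition E N ->
  subspace N /\ forall p x, N x -> N (p ** x).
Proof.
case=> [[_ _ ->] | [e [_ _ _ ->]]]; split=> //; first by apply/subspaceP.
  apply/subspaceP; split=> [|a u v /= eu ev]; first exact: pmul0r.
  by rewrite pmulDr pmulZr eu ev scaler0 addr0.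
by move=> p x /= ex; rewrite pmulCA ex pmul0r.
Qed.

(** If [N] is not all of [P], then modulo [N] every element is a multiple of the
    idempotent, which annihilates [N] and is central for the bracket. *)
Lemma nil_component_supplement (E N : set P) p :
  idempotent_nil_decomposition E N ->
  exists2 n, N n & forall x, N x -> x ** p = x ** n /\ {[x, p]} = {[x, n]}.
Proof.
case=> [[_ _ ->] | [e [e0 ee _ ->]]]; first by exists p.
have [|[a _ ape] _] := @line_ideal e p; first by rewrite ee; exact: line_id.
exists (p - a *: e) => [|x /= ex].
  by rewrite /= pmulDr -scaleNr pmulZr ee pmulC -ape scaleNr subrr.
rewrite pmulDr pbracketDr -scaleNr pmulZr pbracketZr (pmulC x e) ex.
by rewrite (pbracketC x e) (idempotent_bracket x ee) oppr0 !scaler0 !addr0.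
Qed.

(** * The nil component when its square is a line *)

Section NilComponent.
Variables (N : set P) (c : P).
Hypothesis sN : subspace N.
Hypothesis cube0 : forall x, N x -> x ** x ** x = 0.
Hypothesis mulN : forall x y, N x -> N y -> line c (x ** y).
Hypothesis Nc : N c.
Hypothesis supplN : forall p,
  exists2 n, N n & forall x, N x -> x ** p = x ** n /\ {[x, p]} = {[x, n]}.
Hypothesis mulN0 : ~ forall x y, N x -> N y -> x ** y = 0.

Lemma nil_eigenvector x y a : N x -> x ** y = a *: y -> x ** y = 0.
Proof.
move=> Nx xy; have : a ^+ 3 *: y = 0.
  rewrite -[RHS](pmul0l y) -(cube0 Nx) -!pmulA xy pmulZr xy !pmulZr xy.
  by rewrite !exprS expr0 mulr1 -!scalerA.
move/eqP; rewrite scaler_eq0 expf_eq0 /= => /orP[/eqP a0 | /eqP ->].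
  by rewrite xy a0 scale0r.
exact: pmul0r.
Qed.

Lemma mulNc x : N x -> x ** c = 0.
Proof.
by move=> Nx; have [a _ /esym xc] := mulN Nx Nc; exact: nil_eigenvector xc.
Qed.

(** The line of an element of square zero is a subalgebra, hence an ideal, so
    multiplications by elements of [N] act on it as scalars, necessarily zero. *)
Lemma sq0_annihilates x y : y ** y = 0 -> N x -> x ** y = 0.
Proof.
move=> yy Nx; have [|[a _ /esym xy] _] := @line_ideal y x.
  by rewrite yy; apply: subspace0; exact: subspace_line.
exact: nil_eigenvector xy.
Qed.

Lemma exists_sq_neq0 : exists2 v, N v & v ** v <> 0.
Proof.
apply: contrapT => no_v; apply: mulN0 => x y Nx Ny.
apply: sq0_annihilates => //.
by apply: contrapT => yy; apply: no_v; exists y.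
Qed.

Lemma mulcP p : c ** p = 0.
Proof.
by have [n Nn /(_ c Nc)[-> _]] := supplN p; rewrite pmulC mulNc.
Qed.

(** In the ideal consisting of the multiples of [v] plus the associative ideal
    of [v ** v], the second part is in the line of [c], as [c] annihilates
    [P]. *)
Lemma bracket_span p v : N v -> exists a d, {[p, v]} = a *: v + d *: c.
Proof.
move=> Nv.
have [_ _ idB] := dedP (poisson_subalgebra_line_principal v).
have [|a _ [z [l [q ->]] <-]] := idB p v.
  exists 1 => //; exists 0; last by rewrite scale1r addr0.
  by apply: subspace0; exact: subspace_principal.
have [b _ <-] := mulN Nv Nv.
by exists a, (l * b); rewrite pmulZr (pmulC q) mulcP scaler0 addr0 scalerA.
Qed.

(** If [v ** v] is a non-zero multiple of [c], then [{[v ** v, v]} = 0] gives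
    [{[c, v]} = 0]. An [x] of square zero annihilates [N], and is then the
    difference of [v + x] and [v], neither of which has square zero. *)
Lemma bracket_cN x : N x -> {[c, x]} = 0.
Proof.
have sq_neq0 v : N v -> v ** v <> 0 -> {[c, v]} = 0.
  move=> Nv vv; have [a _ ac] := mulN Nv Nv.
  have := pbracket_sq v; rewrite -ac pbracketZl => /eqP.
  rewrite scaler_eq0 => /orP[/eqP a0|/eqP //].
  by case: vv; rewrite -ac a0 scale0r.
move=> Nx; have [xx|/eqP] := eqVneq (x ** x) 0; last exact: sq_neq0.
have [v Nv vv] := exists_sq_neq0.
have vx : v ** x = 0 by exact: sq0_annihilates.
have := sq_neq0 (v + x); rewrite pbracketDr sq_neq0 // add0r; apply.
  exact: subspaceD.
by rewrite pmulDl !pmulDr (pmulC x) vx xx !addr0.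
Qed.

Lemma bracket_cP p : {[c, p]} = 0.
Proof. by have [n Nn /(_ c Nc)[_ ->]] := supplN p; exact: bracket_cN. Qed.

(** [{[u, v]}] lies both in the span of [u] and [c] and in that of [v] and [c].
    If it is not already a multiple of [c], then [v] is a combination of [u]
    and [c], and both of these have zero bracket with [u]. *)
Lemma bracket_line u v : N u -> N v -> line c {[u, v]}.
Proof.
move=> Nu Nv.
have [a [d uv]] := bracket_span u Nv.
have [b [k vu]] := bracket_span v Nu.
have [a0|a0] := eqVneq a 0; first by rewrite uv a0 scale0r add0r; exists d.
have : v = a^-1 *: (- b *: u + (- k - d) *: c).
  have <- : a *: v = - b *: u + (- k - d) *: c.
    apply: (addIr (d *: c)); rewrite -uv -addrA -scalerDl subrK.
    by rewrite pbracketC vu opprD !scaleNr.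
  by rewrite scalerA mulVf // scale1r.
move=> ->; rewrite pbracketZr pbracketDr !pbracketZr pbracketxx.
rewrite (pbracketC u c) bracket_cP oppr0 !scaler0 addr0 scaler0.
by apply: subspace0; exact: subspace_line.
Qed.

(** [{[z, x]}] lies both in the line of [z], which is a subalgebra, and in the
    line of [c]. *)
Lemma bracket_annihilator z x :
  N z -> N x -> z ** z = 0 -> (line c z -> z = 0) -> {[z, x]} = 0.
Proof.
move=> Nz Nx zz zc.
have [|_ [a _ xz]] := @line_ideal z x.
  by rewrite zz; apply: subspace0; exact: subspace_line.
have [a0|a0] := eqVneq a 0; first by rewrite pbracketC -xz a0 scale0r oppr0.
rewrite zc ?pbracket0l //; rewrite -[z]scale1r -(mulVf a0) -scalerA xz.
by apply: subspaceZ; [exact: subspace_line | exact: bracket_line].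
Qed.

Lemma subspace_ann : subspace (ann N).
Proof.
apply/subspaceP; split; first by split=> [|x _]; [exact: subspace0 | exact: pmul0l].
move=> a u v [Nu u0] [Nv v0]; split=> [|x Nx].
  by apply: subspaceD => //; exact: subspaceZ.
by rewrite pmul_linear_l u0 // v0 // scaler0 addr0.
Qed.

Lemma line_sub_ann : line c `<=` ann N.
Proof.
move=> _ [a _ <-]; split=> [|x Nx]; first exact: subspaceZ.
by rewrite pmulZl mulcP scaler0.
Qed.

End NilComponent.

End DedekindAlgebra.

(** Both [beta] and [omega] come from this, applied to the product and to the
    bracket. *)
Lemma line_valued_form (F : fieldType) (W : lmodType F) (V : set W) (c : W)
    (op : W -> W -> W) :
  c <> 0 -> subspace V ->
  (forall a x y z, op (a *: x + y) z = a *: op x z + op y z) ->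
  (forall a x y z, op z (a *: x + y) = a *: op z x + op z y) ->
  (forall u v, V u -> V v -> line c (op u v)) ->
  exists2 f : W -> W -> F, bilinear_form_on V f
    & forall u v, V u -> V v -> op u v = f u v *: c.
Proof.
move=> c0 /subspaceP[_ VL] opl opr opV.
pose f u v := xget 0 [set a | op u v = a *: c].
have fP u v : V u -> V v -> op u v = f u v *: c.
  move=> Vu Vv; have [a _ /esym ac] := opV _ _ Vu Vv.
  by rewrite /f; case: xgetP => [b -> //|/(_ a)]; case.
have inj : injective (fun a : F => a *: c).
  move=> a b /eqP; rewrite -subr_eq0 -scalerBl scaler_eq0 subr_eq0.
  by case/orP=> /eqP.
exists f => //; split=> a u v w Vu Vv Vw; apply: inj => /=;
  rewrite -fP ?opl ?opr ?fP ?scalerDl ?scalerA //; exact: VL.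
Qed.

(** * The structure theorem *)

Theorem proposition5p6 (F : fieldType) (P : poissonAlgType F)
    (E N : set P) (c : P) :
  dedekind P ->
  idempotent_nil_decomposition E N ->
  mulspan N N = line c ->
  line c <> [set 0] ->
  exists V Z : set P,
    [/\ subspace V /\ V `<=` N,
        subspace Z /\ Z `<=` N,
        is_direct_sum N [:: V; Z; line c],
        is_direct_sum (ann N) [:: Z; line c]
      & exists beta omega : P -> P -> F,
          [/\ bilinear_form_on V beta /\ bilinear_form_on V omega,
              forall u v, V u -> V v ->
                u ** v = beta u v *: c /\ {[u, v]} = omega u v *: c,
              symmetric_on V beta /\
                (forall v, V v -> v <> 0 -> beta v v <> 0)
            & alternating_on V omega]] /\
    [/\ forall z p, Z z -> z ** p = 0,
        forall x p, line c x -> x ** p = 0,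
        forall z p, Z z -> {[z, p]} = 0
      & forall p, {[c, p]} = 0].
Proof.
move=> dedP decN spanN line0.
have [sN idealN] := nil_component_ideal decN.
have cube0 x (Nx : N x) := nil_component_cube0 dedP decN Nx.
have supplN p := nil_component_supplement dedP p decN.
have mulN x y : N x -> N y -> line c (x ** y).
  move=> Nx Ny; rewrite -spanN; exists 1%N, (fun=> 1), (fun=> x ** y).
  by rewrite big_ord1 scale1r; split=> // _; exists x => //; exists y.
have c0 : c <> 0.
  move=> c0; apply: line0; apply/seteqP; split=> [_ [a _ <-] | _ ->] /=.
    by rewrite c0 scaler0.
  by apply: subspace0; exact: subspace_line.
have [n [a [v [Nv ac]]]] : mulspan N N c by rewrite spanN; exact: line_id.
have Nc : N c.
  rewrite ac; elim/big_ind: _ => [|x y|i _]; first exact: subspace0.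
    exact: subspaceD.
  by apply: subspaceZ => //; have [x Nx [y Ny <-]] := Nv i; exact: idealN.
have mulN0 : ~ forall x y, N x -> N y -> x ** y = 0.
  move=> N2; apply: c0; rewrite ac big1 // => i _.
  by have [x Nx [y Ny <-]] := Nv i; rewrite N2 // scaler0.
have cP := mulcP cube0 mulN Nc supplN.
have brcP := bracket_cP dedP sN cube0 mulN Nc supplN mulN0.
have brN := bracket_line dedP sN cube0 mulN Nc supplN mulN0.
have cA := line_sub_ann sN cube0 mulN Nc supplN.
have [Z [sZ ZA Zc dirA]] := direct_sum_extend
  (subspace_ann sN) (subspace_line c) cA (direct_sum_line c).
have AN : ann N `<=` N by move=> x [].
have [V [sV VN VA dirN]] := direct_sum_extend sN (subspace_ann sN) AN dirA.
have [beta bil_beta betaP] : exists2 f, bilinear_form_on V f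
    & forall u v, V u -> V v -> u ** v = f u v *: c.
  apply: line_valued_form => // *; first exact: pmul_linear_l.
    by rewrite pmulDr pmulZr.
  by apply: mulN; exact: VN.
have [omega bil_omega omegaP] : exists2 f, bilinear_form_on V f
    & forall u v, V u -> V v -> {[u, v]} = f u v *: c.
  apply: line_valued_form => // *; first exact: pbracket_linear_l.
    exact: pbracket_linear_r.
  by apply: brN; exact: VN.
have injc k : k *: c = 0 -> k = 0.
  by move/eqP; rewrite scaler_eq0 => /orP[/eqP //|/eqP].
exists V, Z; split; first split=> //; first by split=> // x /ZA/AN.
- exists beta, omega; split=> //.
  + by move=> u w Vu Vw; rewrite betaP ?omegaP.
  + split=> [u w Vu Vw | u Vu u0 buu].
      apply/eqP; rewrite -subr_eq0; apply/eqP/injc.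
      by rewrite scalerBl -!betaP // pmulC subrr.
    have uu : u ** u = 0 by rewrite betaP // buu scale0r.
    apply: u0; have : (V `&` ann N) u.
      split=> //; split=> [|x Nx]; first exact: VN.
      by rewrite pmulC; exact: (sq0_annihilates dedP cube0).
    by rewrite VA.
  + by move=> u Vu; apply: injc; rewrite -omegaP // pbracketxx.
- split=> // [z p Zz | _ p [k _ <-] | z p Zz].
  + have [Nz zA] := ZA z Zz.
    by have [m Nm /(_ z Nz)[-> _]] := supplN p; exact: zA.
  + by rewrite pmulZl cP scaler0.
  + have [Nz zA] := ZA z Zz.
    have [m Nm /(_ z Nz)[_ ->]] := supplN p.
    apply: (bracket_annihilator dedP sN cube0 mulN Nc supplN mulN0) => //.
      exact: zA.
    by move=> cz; have : (Z `&` line c) z by []; rewrite Zc.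
Qed.
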